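(* Let $n\geq 1$ be an integer and let $k=p2^{q}$, where $p$ is an odd positive integer and $q$ is a positive integer. Let $G$ be a complete balanced $k$-partite graph with $n$ vertices in each part. Then $W(G)\geq (2k-p-q)n-1$.
   Context: All graphs are finite, undirected, without loops or multiple edges. A complete $k$-partite graph is a graph whose vertex set is partitioned into $k$ independent sets $V_1,\ldots,V_k$ such that every vertex of $V_i$ is adjacent to every vertex of $V_j$ for all $i\neq j$; it is balanced if $|V_1|=\cdots=|V_k|$. An edge-coloring of a graph $G$ with colors $1,\ldots,t$ is an interval $t$-coloring if every color $1,\ldots,t$ is used on at least one edge, and for each vertex the colors of the edges incident to it are pairwise distinct and form a set of consecutive integers. $G$ is interval colorable if it has an interval $t$-coloring for some positive integer $t$; for an interval colorable $G$, $W(G)$ denotes the greatest $t$ such that $G$ has an interval $t$-coloring. *)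

(* Defs.v *)
From mathcomp Require Import all_boot.
From mathcomp Require Import boolp classical_sets.

Set Implicit Arguments.
Unset Strict Implicit.
Unset Printing Implicit Defensive.

Record sgraph := SGraph {
  vertex :> finType;
  adj : rel vertex;
  adj_sym : symmetric adj;
  adj_irrefl : irreflexive adj
}.

Definition edges (G : sgraph) : {set {set G}} :=
  [set E | [exists x, exists y, adj x y && (E == [set x; y]%SET)]]%SET.

Definition edges_at (G : sgraph) (v : G) : {set {set G}} :=
  [set E in edges G | v \in E]%SET.

Definition independent (G : sgraph) (A : {set G}) : Prop :=
  {in A &, forall x y, ~~ adj x y}.

Definition complete_multipartite_on (G : sgraph) (P : {set {set G}}) : Prop :=
  [/\ finset.partition P [set: G]%SET,
      {in P, forall A : {set G}, independent A} &
      {in P &, forall A B : {set G}, A != B -> {in A & B, forall x y, adj x y}}].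

Definition complete_balanced_multipartite (G : sgraph) (k n : nat) : Prop :=
  exists P : {set {set G}},
    [/\ complete_multipartite_on P, #|P| = k & {in P, forall A : {set G}, #|A| = n}].

(* Only the values of [c] on [edges G] matter. *)
Definition interval_coloring (G : sgraph) (t : nat) (c : {set G} -> nat) : Prop :=
  [/\ {in edges G, forall E, 1 <= c E <= t},
      forall j, 1 <= j <= t -> exists2 E, E \in edges G & c E = j,
      forall v : G, {in edges_at v &, injective c} &
      forall v : G, {in edges_at v &, forall E F, forall j, c E <= j <= c F ->
        exists2 H, H \in edges_at v & c H = j}].

Definition has_interval_coloring (G : sgraph) (t : nat) : Prop :=
  exists c : {set G} -> nat, interval_coloring t c.

Definition interval_colorable (G : sgraph) : Prop :=
  exists2 t, 0 < t & has_interval_coloring G t.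

Definition greatest_interval (G : sgraph) (w : nat) : Prop :=
  has_interval_coloring G w /\ forall t, has_interval_coloring G t -> t <= w.

(* Meaningful only when [G] is interval colorable; the default value is 0. *)
Definition W (G : sgraph) : nat := xget 0 [set w | greatest_interval G w]%classic.

Lemma interval_coloring_le (G : sgraph) (t : nat) :
  has_interval_coloring G t -> t <= #|edges G|.
Proof.
case=> c [_ c_onto _ _].
have sub : {subset iota 1 t <= [seq c E | E <- enum (edges G)]}.
  move=> j; rewrite mem_iota add1n ltnS => /c_onto[E EG <-].
  by apply: map_f; rewrite mem_enum.
by have := uniq_leq_size (iota_uniq 1 t) sub; rewrite size_iota size_map -cardE.
Qed.

Lemma W_greatest (G : sgraph) :
  interval_colorable G -> greatest_interval G (W G).
Proof.
case=> t _ tG; rewrite /W; case: xgetP => [w _ //|none].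
have ex : exists t, `[< has_interval_coloring G t >] by exists t; apply/asboolP.
have ub s : `[< has_interval_coloring G s >] -> s <= #|edges G|.
  by move/asboolP/interval_coloring_le.
case: (ex_maxnP ex ub) => w /asboolP wG wmax.
by case: (none w); split=> // s /asboolP; apply: wmax.
Qed.

(* Main.v *)
Require Import Defs.
From mathcomp Require Import all_boot all_algebra.
From mathcomp Require Import zify.

(** A coloring of [K_m] in which the spectrum of every vertex [x] is
    [[a x, a x + m - 1)] yields colorings of two larger graphs.
    - [K_(2m)]: keep the colors on one copy, add [2m - 1] to them on the other,
      give the edge between [x] and the copy of [y != x] the color of [xy] plus
      [m - 1], and the edge between the two copies of [x] the color
      [a x + 2(m - 1)].  This gains [2m - 1] colors.
    - [n] vertices in each of [m] parts: the edge between the [i]-th vertex of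
      part [x] and the [j]-th vertex of part [y] gets color [n c + i + j], where
      [c] is the color of [xy].  From [t] colors this produces [(t + 1) n - 1].
    It remains to color [K_(2p)] with [3p - 2] colors.  Inside both copies of
    [K_p], [ij] gets [i + j] if this is less than [p], and [i + j + p - 1]
    otherwise; the [i]-th vertex then only lacks the value of this formula at
    [j = i], which goes to the edge between its two copies, and the [p - 1] colors
    from [p] to [2p - 2], which are distributed cyclically on the other edges
    between the copies. *)

Set Implicit Arguments.
Unset Strict Implicit.
Unset Printing Implicit Defensive.

Lemma inj_interval_onto (T : finType) (A : {set T}) (f : T -> nat) (a : nat) :
  {in A &, injective f} -> {in A, forall x, a <= f x < a + #|A|} ->
  forall c, a <= c < a + #|A| -> exists2 x, x \in A & f x = c.
Proof.
move=> f_inj f_int c c_int.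
have sub : {subset [seq f x | x <- enum A] <= iota a #|A|}.
  by move=> c0 /mapP[x]; rewrite mem_enum mem_iota => xA ->; apply: f_int.
have f_uniq : uniq [seq f x | x <- enum A].
  by rewrite map_inj_in_uniq ?enum_uniq // => x y; rewrite !mem_enum; apply: f_inj.
have [|_ eqm] := uniq_min_size f_uniq sub; first by rewrite size_iota size_map -cardE.
have : c \in iota a #|A| by rewrite mem_iota.
by rewrite -eqm => /mapP[x]; rewrite mem_enum => xA ->; exists x.
Qed.

Definition neighbors (G : sgraph) (x : G) : {set G} := [set y | adj x y].

Lemma edges_atP (G : sgraph) (v : G) (E : {set G}) :
  reflect (exists2 w, adj v w & E = [set v; w]) (E \in edges_at v).
Proof.
rewrite !inE; apply: (iffP andP) => [[/existsP[x /existsP[y]]]|[w vw ->]].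
  move=> /andP[xy /eqP->]; rewrite !inE => /orP[]/eqP->; first by exists y.
  by exists x; rewrite 1?adj_sym // setUC.
by split; rewrite ?set21 //; apply/existsP; exists v; apply/existsP; exists w; rewrite vw eqxx.
Qed.

Lemma set2_inj (T : finType) (v x y : T) : [set v; x] = [set v; y] -> x = y.
Proof.
move=> E; have := set22 v x; have := set22 v y.
by rewrite -{1}E {2}E !inE => /orP[]/eqP-> // /orP[]/eqP.
Qed.

Section AdjacencyColoring.
Variables (G : sgraph) (t : nat) (f : G -> G -> nat) (a : G -> nat).
Hypothesis f_sym : commutative f.

(** [f] counts colors from 0, hence the successor. Whichever ordered pair [pick] returns, the color
    is the same because [f] is symmetric. *)
Let col (E : {set G}) : nat :=
  if [pick u : G * G | E == [set u.1; u.2]] is Some u then (f u.1 u.2).+1 else 0.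

Let colE x y : col [set x; y] = (f x y).+1.
Proof.
rewrite /col; case: pickP => [[u v] /= /eqP E|/(_ (x, y))]; last by rewrite eqxx.
have := set21 u v; rewrite -E !inE => /orP[]/eqP eu; subst u.
  by rewrite (set2_inj E).
by rewrite setUC in E; rewrite (set2_inj E) f_sym.
Qed.

Hypothesis f_inj : forall x, {in neighbors x &, injective (f x)}.
Hypothesis f_int : forall x, {in neighbors x, forall y, a x <= f x y < a x + #|neighbors x|}.
Hypothesis a_le : forall x, a x + #|neighbors x| <= t.

(* Colors that are too large for the vertex with the smallest spectrum belong to
   the spectrum of the other one, because the edge [xy] belongs to both. *)
Lemma has_interval_coloring_of_adj (x y : G) :
  adj x y -> a x = 0 -> a y + #|neighbors y| = t -> has_interval_coloring G t.
Proof.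
move=> xy ax0 ayt; have onto z := inj_interval_onto (@f_inj z) (@f_int z).
have edgeI u v : adj u v -> [set u; v] \in edges G.
  by move=> uv; have /edges_atP : exists2 w, adj u w & [set u; v] = [set u; w];
    [exists v | rewrite inE => /andP[]].
exists col; split.
- move=> _ /[1!inE] /existsP[u /existsP[v /andP[uv /eqP->]]].
  have /f_int : v \in neighbors u by rewrite inE.
  by have := a_le u; rewrite colE; lia.
- case=> // j /andP[_ jt].
  have [z /onto[w zw <-]] : exists z, a z <= j < a z + #|neighbors z|.
    have [jx|jx] := ltnP j #|neighbors x|; first by exists x; rewrite ax0.
    exists y.
    have /f_int : y \in neighbors x by rewrite inE.
    have /f_int : x \in neighbors y by rewrite inE adj_sym.
    by rewrite (f_sym y x); lia.
  by exists [set z; w]; rewrite ?colE //; apply: edgeI; rewrite inE in zw.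
- move=> v _ _ /edges_atP[w vw ->] /edges_atP[z vz ->].
  by rewrite !colE => -[/f_inj->]; rewrite ?inE.
- move=> v _ _ /edges_atP[w vw ->] /edges_atP[z vz ->] [|j]; rewrite !colE // => wjz.
  have /f_int w_int : w \in neighbors v by rewrite inE.
  have /f_int z_int : z \in neighbors v by rewrite inE.
  have [|u vu <-] := onto v j; first by lia.
  by exists [set v; u]; rewrite ?colE //; apply/edges_atP; exists u; rewrite // inE in vu *.
Qed.

End AdjacencyColoring.

(* An interval [t]-coloring of the complete graph on [T] with colors from [0] to
   [t - 1]: [f x y] is the color of the edge [xy], junk for [x = y], and [a x] is
   the smallest color at [x]. *)
Definition complete_coloring (T : finType) (t : nat) : Prop :=
  exists (f : T -> T -> nat) (a : T -> nat),
    [/\ commutative f,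
        forall x y z, y != x -> z != x -> f x y = f x z -> y = z,
        forall x y, y != x -> a x <= f x y < a x + #|T|.-1,
        forall x, a x + #|T|.-1 <= t &
        exists x y, [/\ x != y, a x = 0 & a y + #|T|.-1 = t]].

Lemma complete_coloring_double (T : finType) (t : nat) :
  complete_coloring T t -> complete_coloring (T * bool)%type (t + 2 * #|T| - 1).
Proof.
case=> f [a [f_sym f_inj f_int a_le [x0 [y0 [_ ax0 ay0]]]]].
have T_gt0 : 0 < #|T| by apply/card_gt0P; exists x0.
have dE : #|{: T * bool}|.-1 = (#|T|.-1 + #|T|.-1).+1.
  by rewrite card_prod card_bool; lia.
have cardT : #|T| = #|T|.-1.+1 by rewrite prednK.
move: #|T|.-1 cardT f_int a_le ay0 dE => d cardT f_int a_le ay0 dE.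
(* With [d = #|T| - 1], the spectrum of [(x, false)] consists of [d] colors inside its copy, [d]
   across, then [a x + 2d]. That of [(x, true)] starts at [a x + d]: [d] across, [a x + 2d], then
   [d] inside. *)
exists (fun u v : T * bool =>
  if u.1 == v.1 then a u.1 + (d + d) else f u.1 v.1 + d * (u.2 + v.2) + (u.2 && v.2)).
exists (fun u : T * bool => a u.1 + d * u.2).
rewrite dE cardT; split.
- move=> [x b] [y c] /=; rewrite eq_sym f_sym addnC andbC.
  case: eqP => [->|_] //; lia.
- move=> [x b] [y c] [z e] /=; rewrite !xpair_eqE (eq_sym x y) (eq_sym x z).
  case: (eqVneq y x) => [->|yx]; case: (eqVneq z x) => [->|zx] /=.
  + by case: b; case: c; case: e.
  + by move=> bc _; have := f_int _ _ zx; case: b bc; case: c; case: e => //=; lia.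
  + by move=> _ bc; have := f_int _ _ yx; case: b bc; case: c; case: e => //=; lia.
  + move=> _ _ E; have yP := f_int _ _ yx; have zP := f_int _ _ zx.
    (* Changing the copy shifts the color by at least [d], but [f x y] and [f x z] differ by less
       than [d]. *)
    have [ce fE] : c = e /\ f x y = f x z.
      by case: b E; case: c; case: e => //= E; split=> //; lia.
    by rewrite ce (f_inj _ _ _ yx zx fE).
- move=> [x b] [y c] /=; rewrite !xpair_eqE (eq_sym x y).
  case: (eqVneq y x) => [_|yx] /=; first by case: b; case: c => //= _; lia.
  by move=> _; have := f_int _ _ yx; case: b; case: c => /=; lia.
- by move=> [x b] /=; have := a_le x; case: b => /=; lia.
- exists (x0, false), (y0, true); rewrite !xpair_eqE andbF /= ax0; split=> //; lia.
Qed.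

Lemma complete_coloring_base (p : nat) :
  0 < p -> complete_coloring ('I_p * bool)%type (3 * p - 2).
Proof.
move=> p_gt0.
have dE : #|{: 'I_p * bool}|.-1 = 2 * p - 1 by rewrite card_prod card_bool card_ord; lia.
pose g (i j : nat) := if i + j < p then i + j else i + j + p - 1.
(* This is [p - 1] plus [j - i] modulo [p]. The first argument is always the index in the copy
   [false], which keeps the coloring symmetric. *)
pose h (i j : nat) := p - 1 + (if i <= j then j - i else p + j - i).
exists (fun u v : 'I_p * bool =>
  if (u.2 == v.2) || (u.1 == v.1) then g u.1 v.1
  else if u.2 then h v.1 u.1 else h u.1 v.1).
exists (fun u : 'I_p * bool => u.1 : nat).
rewrite dE; split.
- move=> [i b] [j c] /=; rewrite (eq_sym i) (eq_sym b) /g (addnC i).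
  by case: b; case: c; rewrite //=; case: eqP.
- move=> [i b] [j c] [l e] /=.
  rewrite !xpair_eqE -!val_eqE /= => jc le E.
  suff [jl ce] : j = l :> nat /\ c = e by rewrite ce; congr (_, _); apply: val_inj.
  move: (ltn_ord i) (ltn_ord j) (ltn_ord l) jc le E; rewrite /g /h.
  by case: b; case: c; case: e => /=; repeat case: ifP => /=; lia.
- move=> [i b] [j c] /=; rewrite !xpair_eqE -!val_eqE /=.
  by move: (ltn_ord i) (ltn_ord j); rewrite /g /h; case: b; case: c => /=;
    repeat case: ifP => /=; lia.
- by move=> [i b] /=; have := ltn_ord i; lia.
- have p1_lt : p.-1 < p by lia.
  (* Taking different copies keeps the two vertices distinct when [p = 1]. *)
  exists (Ordinal p_gt0, false), (Ordinal p1_lt, true).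
  by rewrite !xpair_eqE andbF /=; split=> //; lia.
Qed.

Lemma complete_coloring_p2q (p q : nat) :
  0 < p -> 0 < q -> exists2 T : finType,
    #|T| = p * 2 ^ q & complete_coloring T (2 * (p * 2 ^ q) - p - q - 1).
Proof.
move=> p_gt0; elim: q => // -[_ _|q IHq _].
  exists ('I_p * bool)%type; first by rewrite card_prod card_ord card_bool.
  have -> : 2 * (p * 2 ^ 1) - p - 1 - 1 = 3 * p - 2 by lia.
  exact: complete_coloring_base.
have [//|T cardT colT] := IHq.
exists (T * bool)%type; first by rewrite card_prod card_bool cardT -mulnA -expnSr.
have := complete_coloring_double colT; rewrite cardT.
(* This makes the truncated subtractions below exact. *)
have : q.+1 < 2 ^ q.+1 by apply: ltn_expl.
rewrite (expnS 2 q.+1); set s := 2 ^ q.+1 => qs.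
by have -> : 2 * (p * s) - p - q.+1 - 1 + 2 * (p * s) - 1
           = 2 * (p * (2 * s)) - p - q.+2 - 1 by nia.
Qed.

Lemma complete_balanced_coordinates (G : sgraph) (T : finType) (n : nat) :
  complete_balanced_multipartite G #|T| n ->
  exists g : G -> T * 'I_n,
    bijective g /\ forall u v, adj u v = ((g u).1 != (g v).1).
Proof.
case=> P [[partP indP compP] cardP cardA].
have [/eqP covP trivP _] := and3P partP.
have inP u : pblock P u \in P by rewrite pblock_mem // covP inE.
have in_pb u : u \in pblock P u by rewrite mem_pblock covP inE.
have rk_lt (u : G) : index (pblock P u) (enum P) < #|T|.
  by rewrite -cardP cardE index_mem mem_enum.
have ix_lt (u : G) : index u (enum (pblock P u)) < n.
  by rewrite -(cardA _ (inP u)) cardE index_mem mem_enum.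
pose g u := (enum_val (Ordinal (rk_lt u)), Ordinal (ix_lt u)).
have g1E u v : ((g u).1 == (g v).1) = (pblock P u == pblock P v).
  apply/eqP/eqP => [/enum_val_inj[E]|E]; last first.
    by congr enum_val; apply: val_inj; rewrite /= E.
  by apply: (index_inj set0 _ _ E); rewrite ?mem_enum.
exists g; split.
  apply: inj_card_bij.
    move=> u v E; have /eqP := congr1 fst E; rewrite g1E => /eqP pE.
    have /(congr1 val) := congr1 snd E; rewrite /= pE => iE.
    by apply: (index_inj u _ _ iE); rewrite mem_enum // -pE.
  rewrite card_prod card_ord -cardP -cardsT.
  by rewrite (card_uniform_partition cardA partP).
move=> u v; rewrite g1E; case: eqP => [E|/eqP E] /=.
  by apply/negbTE; apply: (indP _ (inP u)); rewrite // E.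
exact: (compP _ _ (inP u) (inP v) E).
Qed.

Lemma has_interval_coloring_blowup (G : sgraph) (T : finType) (n t : nat) :
  0 < n -> complete_balanced_multipartite G #|T| n -> complete_coloring T t ->
  has_interval_coloring G (t.+1 * n - 1).
Proof.
move=> n_gt0 /complete_balanced_coordinates[g [[g' gK g'K] adjE]].
case=> f [a [f_sym f_inj f_int a_le [x [y [xy ax0 ayt]]]]].
have deg (u : G) : #|neighbors u| = #|T|.-1 * n.
  have -> : neighbors u = g @^-1: setX [set~ (g u).1] [set: 'I_n].
    by apply/setP=> v; rewrite !inE adjE eq_sym andbT.
  rewrite on_card_preimset; last by exists g' => v _; rewrite ?gK ?g'K.
  by rewrite cardsX cardsC1 cardsT card_ord.
(* Offset 0 attains the smallest color, offset [n - 1] the largest. *)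
pose i0 := Ordinal n_gt0; pose u := g' (x, i0); pose v := g' (y, rev_ord i0).
pose F w z := n * f (g w).1 (g z).1 + (g w).2 + (g z).2.
apply: (@has_interval_coloring_of_adj G _ F (fun w => n * a (g w).1 + (g w).2) _ _ _ _ u v).
- by move=> w z; rewrite /F f_sym addnAC.
- move=> w z1 z2; rewrite !inE !adjE !(eq_sym (g w).1) /F => wz1 wz2 E.
  (* Division by [n] recovers the color as quotient and the offset as remainder. *)
  have {}E : f (g w).1 (g z1).1 * n + (g z1).2 = f (g w).1 (g z2).1 * n + (g z2).2 by lia.
  have fE : f (g w).1 (g z1).1 = f (g w).1 (g z2).1.
    by have := congr1 (divn^~ n) E; rewrite !divnMDl // !divn_small ?addn0.
  apply: (can_inj gK); rewrite [g z1]surjective_pairing [g z2]surjective_pairing.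
  rewrite (f_inj _ _ _ wz1 wz2 fE); congr (_, _); apply: val_inj.
  by rewrite fE in E; apply: addnI E.
- move=> w z; rewrite inE adjE eq_sym => /f_int; rewrite deg /F.
  by have := ltn_ord (g z).2; nia.
- by move=> w; rewrite deg; have := a_le (g w).1; have := ltn_ord (g w).2; nia.
- by rewrite adjE !g'K.
- by rewrite g'K ax0 muln0.
- by rewrite deg g'K -ayt /= mulSn mulnDl (mulnC (a y)); lia.
Qed.

Theorem theorem8 (n p q k : nat) (G : sgraph)
  (n_ge1 : (1 <= n)%N) (p_odd : odd p) (q_gt0 : (0 < q)%N)
  (k_def : k = (p * 2 ^ q)%N)
  (G_kn : complete_balanced_multipartite G k n) :
  interval_colorable G /\
  ((2%:Z * k%:Z - p%:Z - q%:Z) * n%:Z - 1 <= (W G)%:Z)%R.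
Proof.
have p_gt0 : 0 < p by apply: odd_gt0.
have [T cardT colT] := complete_coloring_p2q p_gt0 q_gt0.
rewrite -k_def in cardT colT; rewrite -cardT in G_kn.
have := has_interval_coloring_blowup n_ge1 G_kn colT.
have k_ge : p + q < 2 * k by have := ltn_expl q (ltnSn 1); rewrite k_def; nia.
have -> : (2 * k - p - q - 1).+1 = 2 * k - p - q by lia.
set t := _ - 1 => tG.
have Gint : interval_colorable G.
  exists t => //; rewrite /t.
  (* Positivity of [t] needs [p + q + 2 <= 2 * k], which is stronger than [k_ge] when [n = 1]. *)
  have := ltn_expl q (ltnSn 1); rewrite k_def; nia.
split=> //.
have [_ /(_ _ tG)] := W_greatest Gint.
rewrite /t; nia.
Qed.
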